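(* Let $n\ge2$ and for $\gamma\in D_n$ put $w(\gamma)=t^{\mathrm{des}_D(\gamma)}q^{\mathrm{maj}(\gamma)}p^{\ell_D(\gamma)}a^{\mathrm{neg}(\gamma)}$. Then $$\sum_{\gamma\in D_n^0}\frac{w(\gamma)}{(t;q)_n}+\frac1t\sum_{\gamma\in D_n^-}\frac{w(\gamma)}{(t;q)_n}+t\sum_{\gamma\in D_n^+}\frac{w(\gamma)}{(t;q)_n}$$ $$=\frac12\sum_{k\ge0}t^k\,\langle u^n\rangle\Big\{e[u]_pe[uq]_p\cdots e[uq^{k-1}]_p\big((a;p)_n\,\hat e[uq^k]_{-a/p;p}+(-a;p)_n\,\hat e[uq^k]_{a/p;p}\big)\Big\},$$ where $\langle u^n\rangle F(u)$ denotes the coefficient of $u^n$ in $F(u)$.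
   Context: $B_n$ is the group of signed permutations of $[n]$ (bijections $\beta$ of $[-n,n]\setminus\{0\}$ with $\beta(-i)=-\beta(i)$), written $\beta=[\beta(1),\dots,\beta(n)]$; $\mathrm{neg}(\beta)=|\{i:\beta(i)<0\}|$; $D_n=\{\gamma\in B_n:\mathrm{neg}(\gamma)\text{ even}\}$. $\mathrm{Des}_B(\gamma)=\{i\in[0,n-1]:\gamma(i)>\gamma(i+1)\}$ with $\gamma(0):=0$ (natural order), $\mathrm{maj}(\gamma)=\sum_{i\in\mathrm{Des}_B(\gamma)}i$. $\mathrm{Des}_D(\gamma)=\{i\in[0,n-1]:\gamma(i)>\gamma(i+1)\}$ with $\gamma(0):=-\gamma(2)$, $\mathrm{des}_D=|\mathrm{Des}_D|$. $\ell_B(\gamma)=\mathrm{inv}(\gamma)-\sum_{i:\gamma(i)<0}\gamma(i)$ with $\mathrm{inv}(\gamma)=|\{(i,j):i<j,\ \gamma(i)>\gamma(j)\}|$, and $\ell_D(\gamma)=\ell_B(\gamma)-\mathrm{neg}(\gamma)$ (the Coxeter length of $D_n$). $D_n^+=\{\gamma\in D_n:0\notin\mathrm{Des}_D(\gamma),\ \gamma(1)<0\}$, $D_n^-=\{\gamma\in D_n:0\in\mathrm{Des}_D(\gamma),\ \gamma(1)>0\}$, $D_n^0=D_n\setminus(D_n^+\cup D_n^-)$. Notation: $(x;p)_0=1$, $(x;p)_m=(1-x)(1-xp)\cdots(1-xp^{m-1})$; $[m]_p=1+\dots+p^{m-1}$, $[m]_p!=[m]_p\cdots[1]_p$, $[0]_p!=1$;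 $[\hat m]_{b,p}!=(-bp;p)_m[m]_p!$; $e[u]_p=\sum_{m\ge0}u^m/[m]_p!$, $\hat e[u]_{b,p}=\sum_{m\ge0}u^m/[\hat m]_{b,p}!$ (so $\hat e[u]_{-a/p;p}=\sum_m u^m/((a;p)_m[m]_p!)$ and $\hat e[u]_{a/p;p}=\sum_m u^m/((-a;p)_m[m]_p!)$). Both sides are formal power series in $t$ (with $1/(t;q)_n$ expanded as a power series in $t$).
   Formalization: The printed identity fails (n=2, a=0: at t^0 the left side is 1, the right 1/(1+p)); the formal theorem has 1/(t;q)_{n+1} in place of 1/(t;q)_n and multiplies the right-hand side by [n]_p!, i.e. takes the coefficient of u^n/[n]_p!. *)

(* Defs.v *)
From HB Require Import structures.
From mathcomp Require Import all_boot all_order all_fingroup all_algebra.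
From mathcomp Require Import fraction mpoly.
Set Implicit Arguments.
Unset Strict Implicit.
Unset Printing Implicit Defensive.
Import Order.TTheory GRing.Theory Num.Theory.
Local Open Scope ring_scope.

(* [(i, false)] encodes i + 1 and [(i, true)] encodes -(i + 1), so that
   [spoint n] stands for the set [-n, n] \ {0}. *)
Notation spoint n := ('I_n * bool)%type (only parsing).

Definition spoint_val n (x : spoint n) : int := (-1) ^+ x.2 * (x.1.+1)%:Z.

Definition spoint_opp n (x : spoint n) : spoint n := (x.1, ~~ x.2).

Lemma spoint_val_opp n (x : spoint n) :
  spoint_val (spoint_opp x) = - spoint_val x.
Proof. by rewrite /spoint_val /spoint_opp /=; case: x.2; rewrite ?mulN1r ?mul1r ?opprK. Qed.

Lemma spoint_val_inj n : injective (@spoint_val n).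
Proof.
by move=> [i [|]] [j [|]]; rewrite /spoint_val /= ?expr1 ?expr0 ?mulN1r ?mul1r //;
  [move/oppr_inj|..]; case=> e; have -> // : i = j by apply: val_inj.
Qed.

Definition Bn (n : nat) : {set {perm spoint n}} :=
  [set b : {perm spoint n} |
     [forall x, b (spoint_opp x) == spoint_opp (b x)]].

(* The value at i in [0, n], with the convention g(0) = 0
   (junk value 0 for i > n). *)
Definition entry n (g : {perm spoint n}) (i : nat) : int :=
  if i is j.+1 then
    if insub j is Some k then spoint_val (g (k, false)) else 0
  else 0.

(* The same with the convention g(0) = - g(2). *)
Definition entryD n (g : {perm spoint n}) (i : nat) : int :=
  if i is 0 then - entry g 2 else entry g i.

Definition neg n (g : {perm spoint n}) : nat :=
  #|[set i : 'I_n | entry g i.+1 < 0]|.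

Definition Dn (n : nat) : {set {perm spoint n}} :=
  [set g in Bn n | ~~ odd (neg g)].

Definition DesB n (g : {perm spoint n}) : {set 'I_n} :=
  [set i : 'I_n | entry g i > entry g i.+1].

Definition maj n (g : {perm spoint n}) : nat := (\sum_(i in DesB g) i)%N.

Definition DesD n (g : {perm spoint n}) : {set 'I_n} :=
  [set i : 'I_n | entryD g i > entryD g i.+1].

Definition desD n (g : {perm spoint n}) : nat := #|DesD g|.

Definition inv n (g : {perm spoint n}) : nat :=
  #|[set ij : 'I_n * 'I_n |
      (ij.1 < ij.2)%N && (entry g ij.1.+1 > entry g ij.2.+1)]|.

Definition lenB n (g : {perm spoint n}) : int :=
  (inv g)%:Z - \sum_(i < n | entry g i.+1 < 0) entry g i.+1.

Definition lenD n (g : {perm spoint n}) : int := lenB g - (neg g)%:Z.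

Definition zero_in_DesD n (g : {perm spoint n}) : bool :=
  [exists i : 'I_n, (i == 0 :> nat) && (i \in DesD g)].

Definition Dn_plus (n : nat) : {set {perm spoint n}} :=
  [set g in Dn n | ~~ zero_in_DesD g && (entry g 1 < 0)].

Definition Dn_minus (n : nat) : {set {perm spoint n}} :=
  [set g in Dn n | zero_in_DesD g && (entry g 1 > 0)].

Definition Dn_zero (n : nat) : {set {perm spoint n}} :=
  Dn n :\: (Dn_plus n :|: Dn_minus n).

Lemma desD_gt0 n (g : {perm spoint n}) : g \in Dn_minus n -> (0 < desD g)%N.
Proof.
rewrite inE => /and3P[_ /existsP[i /andP[_ iD]] _].
by rewrite card_gt0; apply/set0Pn; exists i.
Qed.

Definition qpoch (R : pzRingType) (x p : R) (m : nat) : R :=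
  \prod_(i < m) (1 - x * p ^+ i).

Definition qint (R : pzRingType) (p : R) (m : nat) : R := \sum_(i < m) p ^+ i.

Definition qfact (R : pzRingType) (p : R) (m : nat) : R :=
  \prod_(i < m) qint p i.+1.

Definition qfact_hat (R : pzRingType) (b p : R) (m : nat) : R :=
  qpoch (- (b * p)) p m * qfact p m.

(* Formal power series in one variable, as sequences of coefficients. *)
Definition fps (K : Type) : Type := nat -> K.

Section Fps.
Variable K : fieldType.
Implicit Types (f g : fps K) (c : K).

Definition fps_of_poly (P : {poly K}) : fps K := fun m => P`_m.

Definition fps_one : fps K := fun m => (m == 0%N)%:R.

Definition fps_add f g : fps K := fun m => f m + g m.

Definition fps_scale c f : fps K := fun m => c * f m.

Definition fps_mul f g : fps K := fun m => \sum_(i < m.+1) f i * g (m - i)%N.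

(* The first m coefficients of 1 / f. *)
Fixpoint fps_inv_seq f (m : nat) : seq K :=
  if m is m'.+1 then
    let s := fps_inv_seq f m' in
    rcons s ((f 0%N)^-1 *
      ((m' == 0%N)%:R - \sum_(i < m') f i.+1 * s`_(m' - i.+1)))
  else [::].

(* The inverse of f, provided f(0) != 0. *)
Definition fps_inv f : fps K := fun m => (fps_inv_seq f m.+1)`_m.

Lemma size_fps_inv_seq f m : size (fps_inv_seq f m) = m.
Proof. by elim: m => //= m IH; rewrite size_rcons IH. Qed.

Lemma nth_fps_inv_seq f m i : (i < m)%N -> (fps_inv_seq f m)`_i = fps_inv f i.
Proof.
elim: m => // m IH; rewrite ltnS leq_eqVlt => /orP[/eqP -> //|lt_im].
by rewrite /= nth_rcons size_fps_inv_seq lt_im IH.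
Qed.

Lemma fps_mulfV f : f 0%N != 0 -> fps_mul f (fps_inv f) =1 fps_one.
Proof.
move=> f0 m; rewrite /fps_mul big_ord_recl subn0 /fps_one.
rewrite {1}/fps_inv /= nth_rcons size_fps_inv_seq ltnn eqxx.
rewrite mulrA divff // mul1r.
under [X in _ - X]eq_bigr => i _.
  rewrite nth_fps_inv_seq; last first.
    by rewrite ltn_subrL (leq_ltn_trans _ (ltn_ord i)).
  over.
by rewrite subrK.
Qed.

(* The series f(c u). *)
Definition fps_dilate c f : fps K := fun m => c ^+ m * f m.

(* Multiplication by the variable, and division by the variable of a series
   without constant term. *)
Definition fps_mulX f : fps K := fun m => if m is m'.+1 then f m' else 0.
Definition fps_divX f : fps K := fun m => f m.+1.

Lemma fps_divXK f : f 0%N = 0 -> fps_mulX (fps_divX f) =1 f.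
Proof. by move=> f0 [|m]. Qed.

(* The power series expansion of P / Q, provided Q(0) != 0. *)
Definition fps_frac (P Q : {poly K}) : fps K :=
  fps_mul (fps_of_poly P) (fps_inv (fps_of_poly Q)).

Definition qexp (p : K) : fps K := fun m => (qfact p m)^-1.

Definition qexp_hat (b p : K) : fps K := fun m => (qfact_hat b p m)^-1.

Definition weight n (q p a : K) (g : {perm spoint n}) : {poly K} :=
  (q ^+ maj g * p ^ lenD g * a ^+ neg g) *: 'X^(desD g).

(* A pitfall: in the theorem N = n + 1, and the coefficient of u^n is multiplied
   by [n]_p!, that is, it is the coefficient of u^n / [n]_p!. With (t; q)_n, or
   with the bare coefficient of u^n, the identity fails: at n = 2 and a = 0 the
   left-hand side is (1 + t q p) / (t; q)_N and the coefficient of u^n on the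
   right-hand side at t^0 and t^1 is 1 / (1 + p) and q + (1 + q^2) / (1 + p). *)
(* The sum over A of w(g) / (t; q)_N, as a power series in t. *)
Definition weight_series n (q p a : K) (N : nat) (A : {set {perm spoint n}}) :
    fps K :=
  fun m => \sum_(g in A) fps_frac (weight q p a g) (qpoch 'X q%:P N) m.

(* The dividend of [fps_divX] in the theorem has no constant term. *)
Lemma weight_series_minus0 n (q p a : K) N :
  weight_series q p a N (Dn_minus n) 0 = 0.
Proof.
rewrite /weight_series big1 // => g /desD_gt0 d0.
rewrite /fps_frac /fps_mul big_ord1 /fps_of_poly /= coefZ coefXn.
by rewrite eq_sym (gtn_eqF d0) mulr0 mul0r.
Qed.

Lemma qpochX0 (q : K) N : fps_of_poly (qpoch 'X q%:P N) 0 = 1.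
Proof.
rewrite /fps_of_poly -horner_coef0 /qpoch horner_prod big1 // => i _.
by rewrite !hornerE ?mul0r ?subr0.
Qed.

End Fps.

(* The field Q(q, p, a) of rational functions in three indeterminates. *)
Definition Kqpa : fieldType := {fraction {mpoly rat[3]}}.
Definition q_ind : Kqpa := tofrac ('X_0 : {mpoly rat[3]}).
Definition p_ind : Kqpa := tofrac ('X_1 : {mpoly rat[3]}).
Definition a_ind : Kqpa := tofrac ('X_2 : {mpoly rat[3]}).

(* Main.v *)
Require Import Defs.
From HB Require Import structures.
From mathcomp Require Import all_boot all_order all_fingroup all_algebra.
From mathcomp Require Import fraction mpoly ring zify.
From mathcomp Require boolp.
Import Order.TTheory GRing.Theory Num.Theory.
Local Open Scope ring_scope.
Set Implicit Arguments.
Unset Strict Implicit.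
Unset Printing Implicit Defensive.

(* The factors 1/t and t on D_n^- and D_n^+ turn des_D into des_B, so the
   left-hand side is the part of even neg of a sum over B_n, that is, half the
   sum of the B_n-series at a and at -a. For B_n, the coefficient of t^k of
   t^des q^maj / (t; q)_(n+1) counts the ways to cut the word of gamma into k+1
   increasing, possibly empty, blocks, the first one positive, with weights
   q^k, ..., q, 1 for the letters of the successive blocks. With arbitrary
   weights x_0, ..., x_k instead, inserting the letter n+1 or -(n+1) into a word
   of B_n gives a recursion in n for the sum over B_n in which some of the x_i
   are multiplied by p. The coefficient of u^n in
   e^[x_0 u] e[x_1 u] ... e[x_k u] satisfies the same recursion, because
   e[u] - e[pu] = (1 - p) u e[u] makes it telescope. *)

(** * The ring of formal power series *)

HB.instance Definition _ (K : fieldType) := boolp.gen_eqMixin (fps K).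
HB.instance Definition _ (K : fieldType) := boolp.gen_choiceMixin (fps K).

Section FpsRing.
Variable K : fieldType.
Implicit Types (f g h : fps K) (P Q : {poly K}).

Lemma fpsP f g : f =1 g <-> f = g.
Proof. by split=> [/boolp.funext | ->]. Qed.

(** Coefficients of a product below degree [N] depend only on truncations, so the ring axioms for
    series are inherited from [{poly K}]. *)
Definition fps_trunc N f : {poly K} := \poly_(i < N) f i.

Lemma fps_mul_trunc N f g m : (m < N)%N ->
  fps_mul f g m = (fps_trunc N f * fps_trunc N g)`_m.
Proof.
move=> mN; rewrite coefM; apply: eq_bigr => i _.
by rewrite !coef_poly !(leq_ltn_trans _ mN) ?leq_subr // -ltnS.
Qed.

Lemma coef_trunc_mul N f g i : (i < N)%N ->
  (fps_trunc N (fps_mul f g))`_i = (fps_trunc N f * fps_trunc N g)`_i.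
Proof. by move=> iN; rewrite coef_poly iN (@fps_mul_trunc N). Qed.

Fact fps_addA : associative (@fps_add K).
Proof. by move=> f g h; apply/fpsP => m; apply: addrA. Qed.
Fact fps_addC : commutative (@fps_add K).
Proof. by move=> f g; apply/fpsP => m; apply: addrC. Qed.
Fact fps_add0 : left_id (fun=> 0) (@fps_add K).
Proof. by move=> f; apply/fpsP => m; apply: add0r. Qed.
Fact fps_addN : left_inverse (fun=> 0) (fun f m => - f m) (@fps_add K).
Proof. by move=> f; apply/fpsP => m; apply: addNr. Qed.

Fact fps_mulC : commutative (@fps_mul K).
Proof.
by move=> f g; apply/fpsP => m; rewrite !(@fps_mul_trunc m.+1) // mulrC.
Qed.

Fact fps_mulA : associative (@fps_mul K).
Proof.
move=> f g h; apply/fpsP => m; rewrite !(@fps_mul_trunc m.+1) //.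
transitivity ((fps_trunc m.+1 f * (fps_trunc m.+1 g * fps_trunc m.+1 h))`_m).
  rewrite !coefM; apply: eq_bigr => i _; congr (_ * _).
  by rewrite coef_trunc_mul // ltnS leq_subr.
rewrite mulrA !coefM; apply: eq_bigr => i _; congr (_ * _).
by rewrite coef_trunc_mul.
Qed.

Fact fps_mul1 : left_id (@fps_one K) (@fps_mul K).
Proof.
move=> f; apply/fpsP => m; rewrite /fps_mul big_ord_recl big1 /fps_one ?mul1r.
  by rewrite subn0 addr0.
by move=> i _; rewrite mul0r.
Qed.

Fact fps_mulDl : left_distributive (@fps_mul K) (@fps_add K).
Proof.
move=> f g h; apply/fpsP => m; rewrite /fps_mul /fps_add -big_split /=.
by apply: eq_bigr => i _; rewrite mulrDl.
Qed.

HB.instance Definition _ := GRing.isZmodule.Build (fps K)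
  fps_addA fps_addC fps_add0 fps_addN.

Fact fps_oner_neq0 : @fps_one K != 0.
Proof. by apply/eqP => /fpsP/(_ 0%N)/eqP; rewrite oner_eq0. Qed.

HB.instance Definition _ := GRing.Zmodule_isComNzRing.Build (fps K)
  fps_mulA fps_mulC fps_mul1 fps_mulDl fps_oner_neq0.

Lemma fpsD f g m : (f + g) m = f m + g m. Proof. by []. Qed.
Lemma fpsN f m : (- f) m = - f m. Proof. by []. Qed.
Lemma fpsM f g m : (f * g) m = \sum_(i < m.+1) f i * g (m - i)%N.
Proof. by []. Qed.
Lemma fpsM0 f g : (f * g) 0%N = f 0%N * g 0%N.
Proof. by rewrite fpsM big_ord1. Qed.
Lemma fps_addE f g : fps_add f g = f + g. Proof. by []. Qed.
Lemma fps_mulE f g : fps_mul f g = f * g. Proof. by []. Qed.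

Lemma fps_sumE I (r : seq I) (P : pred I) (F : I -> fps K) m :
  (\sum_(i <- r | P i) F i) m = \sum_(i <- r | P i) F i m.
Proof. by elim/big_rec2: _ => // i x y _ <-. Qed.

Fact fps_of_poly_is_zmod_morphism : zmod_morphism (@fps_of_poly K).
Proof. by move=> P Q; apply/fpsP => m; rewrite /fps_of_poly coefB. Qed.

Fact fps_of_poly_is_monoid_morphism : monoid_morphism (@fps_of_poly K).
Proof.
split=> [|P Q]; apply/fpsP => m; rewrite /fps_of_poly ?coef1 //.
by rewrite coefM.
Qed.

HB.instance Definition _ := GRing.isZmodMorphism.Build _ _ (@fps_of_poly K)
  fps_of_poly_is_zmod_morphism.
HB.instance Definition _ := GRing.isMonoidMorphism.Build _ _ (@fps_of_poly K)
  fps_of_poly_is_monoid_morphism.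

Lemma coef_fpsC c f m : (fps_of_poly c%:P * f) m = c * f m.
Proof.
rewrite fpsM big_ord_recl big1 /fps_of_poly.
  by rewrite coefC subn0 addr0.
by move=> i _; rewrite coefC mul0r.
Qed.

Lemma coef_fpsX0 f : (fps_of_poly 'X * f) 0%N = 0.
Proof. by rewrite fpsM big_ord1 /fps_of_poly coefX mul0r. Qed.

Lemma coef_fpsXS f m : (fps_of_poly 'X * f) m.+1 = f m.
Proof.
rewrite fpsM 2!big_ord_recl big1 /fps_of_poly /= ?coefX ?mul0r ?mul1r.
  by rewrite subSS subn0 addr0 add0r.
by move=> i _; rewrite coefX mul0r.
Qed.

Lemma fps_mulXE f : fps_mulX f = fps_of_poly 'X * f.
Proof. by apply/fpsP => -[|m]; rewrite ?coef_fpsX0 ?coef_fpsXS. Qed.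

Lemma fps_divX_mulX f : fps_divX (fps_of_poly 'X * f) = f.
Proof. by apply/fpsP => m; apply: coef_fpsXS. Qed.

Lemma fps_divX_sum I (r : seq I) (P : pred I) (F : I -> fps K) :
  fps_divX (\sum_(i <- r | P i) F i) = \sum_(i <- r | P i) fps_divX (F i).
Proof. by apply/fpsP => m; rewrite /fps_divX !fps_sumE. Qed.

Lemma fps_dilateM c f g :
  fps_dilate c (f * g) = fps_dilate c f * fps_dilate c g.
Proof.
apply/fpsP => m; rewrite /fps_dilate !fpsM mulr_sumr; apply: eq_bigr => i _.
by rewrite mulrACA -exprD subnKC // -ltnS.
Qed.

Lemma fps_dilate1 c : fps_dilate c 1 = 1.
Proof.
apply/fpsP => -[|m]; rewrite /fps_dilate ?expr0 ?mul1r //.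
exact: mulr0.
Qed.

Lemma fps_dilate_prod c I (r : seq I) (P : pred I) (F : I -> fps K) :
  fps_dilate c (\prod_(i <- r | P i) F i) =
  \prod_(i <- r | P i) fps_dilate c (F i).
Proof.
elim/big_rec2: _ => [|i x y _ <-]; first exact: fps_dilate1.
exact: fps_dilateM.
Qed.

Lemma fps_dilate_dilate c d f :
  fps_dilate c (fps_dilate d f) = fps_dilate (c * d) f.
Proof. by apply/fpsP => m; rewrite /fps_dilate mulrA exprMn. Qed.

End FpsRing.

(** * Cutting words into increasing blocks *)

Definition insert (j : nat) (N : int) (w : seq int) : seq int :=
  take j w ++ N :: drop j w.
Arguments insert : simpl never.

Lemma insert0 N w : insert 0 N w = N :: w.
Proof. by rewrite /insert take0 drop0. Qed.

Lemma insertS j N a w : insert j.+1 N (a :: w) = a :: insert j N w.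
Proof. by []. Qed.

Section BlockSums.
Variable K : fieldType.
Implicit Types (p x : K) (xs : seq K) (w : seq int) (N : int).

Definition le_opt (v : option int) (a : int) : bool :=
  if v is Some b then b <= a else true.

(* Sum over the ways to cut w into [size xs] increasing, possibly empty, blocks
   of the product of the weights of the letters, a letter of block i having
   weight xs`_i. Here v is the letter that precedes w in the current block, or
   None at the start of a block. *)
Fixpoint blocks xs (v : option int) w : K :=
  if xs is x :: xs' then
    (fix scan v w :=
       if w is a :: w' then
         (le_opt v a)%:R * x * scan (Some a) w' + blocks xs' None w
       else 1) v w
  else (nilp w)%:R.

Arguments blocks : simpl never.

Lemma blocks_nil v w : blocks [::] v w = (nilp w)%:R. Proof. by []. Qed.

Lemma blocks_nilr xs v : blocks xs v [::] = 1. Proof. by case: xs. Qed.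

Lemma blocks_cons x xs v a w :
  blocks (x :: xs) v (a :: w) =
  (le_opt v a)%:R * x * blocks (x :: xs) (Some a) w + blocks xs None (a :: w).
Proof. by []. Qed.

(** Every cut uses each letter once, so the sum is homogeneous of degree [size w] in the weights. *)
Lemma blocks_scale c xs v w :
  blocks (map ( *%R c) xs) v w = c ^+ size w * blocks xs v w.
Proof.
elim: xs v w => [|x xs IHx] v w.
  by case: w => [|a w]; rewrite !blocks_nil ?mulr1 ?mulr0.
elim: w v => [|a w IHw] v; first by rewrite !blocks_nilr mulr1.
rewrite map_cons !blocks_cons -map_cons IHw IHx /= exprS; ring.
Qed.

(* The index i of the sum is the block in which a new letter is inserted: a
   maximal letter goes to the end of block i and jumps over all letters of the
   later blocks, whence a factor p for each of them. In [low_sum], a minimal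
   letter goes to the start of block i, and the earlier blocks are scaled. *)
Fixpoint up_sum p (F : seq K -> K) xs : K :=
  if xs is x :: xs' then
    x * F (x :: map ( *%R p) xs') + up_sum p (fun ys => F (x :: ys)) xs'
  else 0.

Fixpoint low_sum p (F : seq K -> K) xs : K :=
  if xs is x :: xs' then
    x * F (x :: xs') + low_sum p (fun ys => F (p * x :: ys)) xs'
  else 0.

Lemma eq_up_sum p F G xs : F =1 G -> up_sum p F xs = up_sum p G xs.
Proof.
elim: xs F G => //= x xs IH F G eqFG; rewrite eqFG; congr (_ + _).
exact: IH.
Qed.

Lemma eq_low_sum p F G xs : F =1 G -> low_sum p F xs = low_sum p G xs.
Proof.
elim: xs F G => //= x xs IH F G eqFG; rewrite eqFG; congr (_ + _).
exact: IH.
Qed.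

Lemma up_sum_lin p c d F G xs :
  up_sum p (fun ys => c * F ys + d * G ys) xs =
  c * up_sum p F xs + d * up_sum p G xs.
Proof. by elim: xs F G => [|x xs IH] F G /=; rewrite ?IH; ring. Qed.

Lemma low_sum_lin p c d F G xs :
  low_sum p (fun ys => c * F ys + d * G ys) xs =
  c * low_sum p F xs + d * low_sum p G xs.
Proof. by elim: xs F G => [|x xs IH] F G /=; rewrite ?IH; ring. Qed.

Lemma up_sum_scale p c F xs :
  up_sum p (fun ys => c * F ys) xs = c * up_sum p F xs.
Proof. by elim: xs F => [|x xs IH] F /=; rewrite ?IH; ring. Qed.

Lemma low_sum_scale p c F xs :
  low_sum p (fun ys => c * F ys) xs = c * low_sum p F xs.
Proof. by elim: xs F => [|x xs IH] F /=; rewrite ?IH; ring. Qed.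

Lemma up_sum_sum p I (r : seq I) (c : I -> K) (F : I -> seq K -> K) xs :
  \sum_(i <- r) c i * up_sum p (F i) xs =
  up_sum p (fun ys => \sum_(i <- r) c i * F i ys) xs.
Proof.
elim: xs F => [|x xs IH] F /=; first by rewrite big1 // => i _; rewrite mulr0.
rewrite -IH mulr_sumr -big_split; apply: eq_bigr => i _ /=; ring.
Qed.

Lemma low_sum_sum p I (r : seq I) (c : I -> K) (F : I -> seq K -> K) xs :
  \sum_(i <- r) c i * low_sum p (F i) xs =
  low_sum p (fun ys => \sum_(i <- r) c i * F i ys) xs.
Proof.
elim: xs F => [|x xs IH] F /=; first by rewrite big1 // => i _; rewrite mulr0.
rewrite -(IH (fun i ys => F i (_ :: ys))) mulr_sumr -big_split.
by apply: eq_bigr => i _ /=; ring.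
Qed.

(** In a cut of [insert j N w] the maximal letter ends its block. Such a cut therefore amounts to a
    cut of [w] with a choice of block for [N], and the [size w - j] letters to the right of [N] are
    those of the later blocks. *)
Lemma blocks_insert_max p xs v w N : all (fun a => a < N) w -> le_opt v N ->
  \sum_(j < (size w).+1) p ^+ (size w - j) * blocks xs v (insert j N w) =
  up_sum p (fun ys => blocks ys v w) xs.
Proof.
elim: xs v w => [|x xs IHx] v w wN vN.
  apply: big1 => j _.
  by rewrite blocks_nil /nilp size_cat addnS /= mulr0.
elim: w v wN vN => [|a w IHw] v wN vN.
  have := IHx None [::] isT isT.
  rewrite !big_ord1 /insert /= blocks_cons vN !mul1r !blocks_nilr mulr1 => ->.
  by congr (_ + _); apply: eq_up_sum => ys; rewrite !blocks_nilr.
have := IHx None (a :: w) wN isT.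
rewrite big_ord_recl subn0 insert0.
under eq_bigr => j _ do rewrite lift0 subSS.
(* [S] is the part of the sum where the current block is closed before [a] and [N] comes after
   [a]. *)
set S := \sum_(j < _) _ => IHx'.
rewrite big_ord_recl subn0 insert0 blocks_cons vN.
under eq_bigr => j _ do
  rewrite lift0 subSS insertS blocks_cons mulrDr mulrCA -insertS.
rewrite big_split -mulr_sumr [\sum_(j < _) _ * blocks xs _ _]/= -/S.
have /andP[aN {}wN] := wN.
(* The smaller letter [a] cannot follow [N] in a block, so the block is closed. *)
have -> : blocks (x :: xs) (Some N) (a :: w) = blocks xs None (a :: w).
  by rewrite blocks_cons /= leNgt aN !mul0r add0r.
rewrite IHw //=; last exact: ltW.
under [in RHS]eq_up_sum => ys do
  rewrite blocks_cons -[blocks ys None _]mul1r.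
rewrite blocks_cons blocks_scale up_sum_lin -IHx' /=; ring.
Qed.

(** A minimal letter begins its block, after the [j] letters of the earlier blocks. The head block
    stands apart because [N] can begin it only if the preceding letter [v] allows. *)
Lemma blocks_insert_min p x xs v w N : all (fun a => N < a) w ->
  \sum_(j < (size w).+1) p ^+ j * blocks (x :: xs) v (insert j N w) =
  (le_opt v N)%:R * x * blocks (x :: xs) None w +
  low_sum p (fun ys => blocks (p * x :: ys) v w) xs.
Proof.
have [m] := ubnP (size xs); elim: m => // m IHm in x xs v w *.
rewrite ltnS => xsm.
(* At the start of a block there is no constraint from [v], so the separate head term merges with
   [low_sum]. *)
have IHx u : all (fun a => N < a) u ->
    \sum_(j < (size u).+1) p ^+ j * blocks xs None (insert j N u) =
    low_sum p (fun ys => blocks ys None u) xs.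
  case: xs xsm => [|y ys] ysm uN; last by rewrite IHm //= !mul1r.
  by apply: big1 => j _; rewrite blocks_nil /nilp size_cat addnS /= mulr0.
elim: w v => [|a w IHw] v wN.
  have := IHx [::] isT.
  rewrite !big_ord1 /insert /= blocks_cons !mul1r !blocks_nilr => ->.
  by congr (_ + _); apply: eq_low_sum => ys; rewrite !blocks_nilr.
have := IHx (a :: w) wN.
rewrite big_ord_recl mul1r insert0.
under eq_bigr => j _ do rewrite lift0 exprS.
set S := \sum_(j < _) _ => IHx'.
rewrite big_ord_recl mul1r insert0 blocks_cons.
have E c d y z : p * c * (d * y + z) = d * p * (c * y) + p * c * z by ring.
under eq_bigr => j _ do rewrite lift0 insertS blocks_cons exprS E -insertS.
rewrite big_split -!mulr_sumr [\sum_(j < _) _ * blocks xs _ _]/= -/S.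
have /andP[aN {}wN] := wN.
(* The head term of [IHw] vanishes: [N] cannot follow the larger letter [a] in its block. *)
rewrite IHw //= [le_opt _ N]/= leNgt aN mul0r mul0r add0r.
under [in RHS]eq_low_sum => ys do
  rewrite blocks_cons -[blocks ys None _]mul1r.
rewrite low_sum_lin -IHx' !blocks_cons /= (ltW aN) /=; ring.
Qed.

End BlockSums.
Arguments blocks : simpl never.

(** * Block sums with weights q^k, ..., q, 1, descents and major index *)

Fixpoint word_des (v : option int) (w : seq int) : nat :=
  if w is a :: w' then (~~ le_opt v a + word_des (Some a) w')%N else 0%N.

(** A descent from [v] to the first letter has index 0. Prepending a letter raises the index of each
    later descent by one, whence the summand [word_des]. *)
Fixpoint word_maj (v : option int) (w : seq int) : nat :=
  if w is a :: w' then (word_maj (Some a) w' + word_des (Some a) w')%N else 0%N.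

Section BlockSeries.
Variables (K : fieldType) (q : K).
Implicit Types (v : option int) (w : seq int).

Definition desc_pows k : seq K := rev (mkseq (fun i => q ^+ i) k).

Lemma desc_powsS k : desc_pows k.+1 = q ^+ k :: desc_pows k.
Proof. by rewrite /desc_pows mkseqS rev_rcons. Qed.

(** The factor with [i = 0] is split off; the others form (qt; q)_m. *)
Lemma fps_dilate_qpoch m :
  fps_of_poly (qpoch 'X q%:P m.+1) =
  (1 - fps_of_poly ('X : {poly K})) *
  fps_dilate q (fps_of_poly (qpoch 'X q%:P m)) :> fps K.
Proof.
rewrite /qpoch big_ord_recl expr0 mulr1 rmorphM rmorphB rmorph1; congr (_ * _).
rewrite !rmorph_prod fps_dilate_prod; apply: eq_bigr => i _.
apply/fpsP => k; rewrite /= /fps_dilate /fps_of_poly !coefB !coef1 -!rmorphXn.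
rewrite /= !coefMC !coefX exprS.
by case: k => [|[|k]]; rewrite /= ?expr0 ?expr1; ring.
Qed.

Definition block_series v w : fps K := fun k => blocks (desc_pows k.+1) v w.

(** With k + 1 blocks, a first letter in the head block has weight q^k, which dilates t by q;
    dropping the head block lowers k by one, which is a factor t. *)
Lemma block_series_cons v a w :
  block_series v (a :: w) =
  fps_of_poly (le_opt v a)%:R * fps_dilate q (block_series (Some a) w) +
  fps_of_poly 'X * block_series None (a :: w).
Proof.
apply/fpsP => k; rewrite fpsD -(rmorph_nat polyC) coef_fpsC /fps_dilate.
rewrite /block_series desc_powsS blocks_cons mulrA; congr (_ + _).
by case: k => [|k]; rewrite ?coef_fpsX0 ?coef_fpsXS.
Qed.

(** Both sides satisfy the same recursion on the word: each letter contributes a dilation by q, a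
    factor 1 / (1 - t), and a factor t if it follows a descent. *)
Lemma block_seriesE v w :
  block_series v w * fps_of_poly (qpoch 'X q%:P (size w).+1) =
  fps_of_poly (q ^+ word_maj v w *: 'X^(word_des v w)).
Proof.
elim: w v => [|a w IHw] v.
  rewrite /qpoch big_ord1 expr0 mulr1 rmorphB rmorph1 mulrBr mulr1 mulrC.
  apply/fpsP => k; rewrite fpsD fpsN scale1r expr0 rmorph1.
  case: k => [|k]; rewrite ?coef_fpsX0 ?coef_fpsXS /block_series !blocks_nilr.
    by rewrite subr0.
  by rewrite subrr.
have IH := congr1 (fps_dilate q) (IHw (Some a)).
rewrite fps_dilateM in IH.
rewrite fps_dilate_qpoch mulrA.
have H0 : block_series None (a :: w) * (1 - fps_of_poly 'X) =
          fps_dilate q (block_series (Some a) w).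
  rewrite mulrBr mulr1 {1}block_series_cons /= mulr1n rmorph1. ring.
have -> : block_series v (a :: w) * (1 - fps_of_poly 'X) =
    fps_of_poly 'X ^+ (~~ le_opt v a) * fps_dilate q (block_series (Some a) w).
  rewrite block_series_cons mulrDl -[_ * _ * _ in X in _ + X]mulrA H0.
  case: le_opt; rewrite ?mulr1n ?rmorph1 ?expr0 ?mul1r; first ring.
  by rewrite rmorph0 !mul0r add0r expr1.
rewrite -mulrA IH; apply/fpsP => k.
rewrite -rmorphXn /=.
(* Dilation turns t^d into q^d t^d, which is the shift of all descent indices by one. *)
have -> : fps_dilate q (fps_of_poly (q ^+ word_maj (Some a) w *:
    'X^(word_des (Some a) w))) = fps_of_poly (q ^+ (word_maj (Some a) w +
    word_des (Some a) w) *: 'X^(word_des (Some a) w)).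
  apply/fpsP => m; rewrite /fps_dilate /fps_of_poly !coefZ coefXn exprD.
  by case: eqP => [->|_]; rewrite ?mulr0n ?mulr0 // mulrA [_ ^+ _ * _]mulrC.
by rewrite -rmorphM /= -scalerAr !exprD.
Qed.

End BlockSeries.

(** * The q-exponential side *)

Section Telescoping.
Variables (K : fieldType) (p b : K).
Hypothesis p_neq1 : p != 1.
Hypothesis qint_neq0 : forall m, qint p m.+1 != 0.
Hypothesis hat_neq0 : forall m, 1 + b * p ^+ m.+1 != 0.

Lemma qint_geom m : (1 - p) * qint p m = 1 - p ^+ m.
Proof. by rewrite -opprB mulNr -subrX1 opprB. Qed.

Lemma qfactS m : qfact p m.+1 = qfact p m * qint p m.+1.
Proof. by rewrite /qfact big_ord_recr. Qed.

Lemma qfact_hatS m :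
  qfact_hat b p m.+1 = qfact_hat b p m * ((1 + b * p ^+ m.+1) * qint p m.+1).
Proof. by rewrite /qfact_hat /qpoch big_ord_recr qfactS exprS /=; ring. Qed.

Lemma qfact_neq0 m : qfact p m != 0.
Proof. by apply/prodf_neq0 => i _. Qed.

Lemma qfact_hat_neq0 m : qfact_hat b p m != 0.
Proof.
rewrite mulf_neq0 ?qfact_neq0 //; apply/prodf_neq0 => i _.
by rewrite mulNr opprK -mulrA -exprS hat_neq0.
Qed.

Lemma coef_fps_scaleX c (f : fps K) m :
  (fps_of_poly (c *: 'X) * f) m.+1 = c * f m.
Proof. by rewrite -mul_polyC rmorphM /= -mulrA coef_fpsC coef_fpsXS. Qed.

Lemma coef0_fps_scaleX c (f : fps K) : (fps_of_poly (c *: 'X) * f) 0%N = 0.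
Proof. by rewrite -mul_polyC rmorphM /= -mulrA coef_fpsC coef_fpsX0 mulr0. Qed.

Lemma qexp_dilate x :
  fps_of_poly (((1 - p) * x) *: 'X) * fps_dilate x (qexp p) =
  fps_dilate x (qexp p) - fps_dilate (p * x) (qexp p).
Proof.
apply/fpsP => -[|m]; rewrite fpsD fpsN ?coef0_fps_scaleX ?coef_fps_scaleX.
  by rewrite /fps_dilate !expr0 subrr.
rewrite /fps_dilate /qexp qfactS.
have [H1 H2] := (qint_neq0 m, qfact_neq0 m).
have -> : 1 - p = (1 - p ^+ m.+1) / qint p m.+1.
  by rewrite -qint_geom mulfK.
by rewrite exprMn !exprS; field; rewrite H1.
Qed.

(** On the coefficient of u^m the right-hand side acts as (1 - p^m)(1 + b p^m), which cancels the
    last factors of [qfact_hat b p m] up to 1 - p. *)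
Lemma qexp_hat_dilate x :
  fps_of_poly (((1 - p) * x) *: 'X) * fps_dilate x (qexp_hat b p) =
  fps_dilate x (qexp_hat b p) - fps_dilate (p * x) (qexp_hat b p) +
  fps_of_poly b%:P * (fps_dilate (p * x) (qexp_hat b p) -
                      fps_dilate (p * (p * x)) (qexp_hat b p)).
Proof.
apply/fpsP => -[|m].
  rewrite !fpsD coef_fpsC !fpsD !fpsN coef0_fps_scaleX.
  by rewrite /fps_dilate !expr0 !subrr mulr0 addr0.
rewrite !fpsD coef_fpsC !fpsD !fpsN coef_fps_scaleX.
rewrite /fps_dilate /qexp_hat qfact_hatS.
have [H1 [H2 H3]] := (qint_neq0 m, (qfact_hat_neq0 m, hat_neq0 m)).
have -> : 1 - p = (1 - p ^+ m.+1) / qint p m.+1.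
  by rewrite -qint_geom mulfK.
by rewrite !exprMn !exprS in H3 *; field; rewrite H1 H2 H3.
Qed.

Definition qexp_prod xs : fps K := \prod_(x <- xs) fps_dilate x (qexp p).

(** The head weight, that of the block of positive letters, carries the modified exponential; 0 is a
    junk value. *)
Definition qexp_hat_prod xs : fps K :=
  if xs is x :: xs' then fps_dilate x (qexp_hat b p) * qexp_prod xs' else 0.

Lemma qexp_step (G : fps K) x n :
  (1 - p) * (x * (G * fps_dilate x (qexp p)) n) =
  (G * fps_dilate x (qexp p)) n.+1 - (G * fps_dilate (p * x) (qexp p)) n.+1.
Proof.
by rewrite mulrA -coef_fps_scaleX mulrCA qexp_dilate mulrBr fpsD fpsN.
Qed.

Lemma qexp_prod_cons (G : fps K) x xs :
  G * qexp_prod (x :: xs) = G * fps_dilate x (qexp p) * qexp_prod xs.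
Proof. by rewrite /qexp_prod big_cons mulrA. Qed.

(** By [qexp_step] the summand of index i is the difference between the products with the first i
    and the first i + 1 weights scaled by [p]. The series [G] absorbs the factors already passed. *)
Lemma low_sum_telescope (G : fps K) xs n :
  (1 - p) * low_sum p (fun ys => (G * qexp_prod ys) n) xs =
  (G * qexp_prod xs) n.+1 - (G * qexp_prod (map ( *%R p) xs)) n.+1.
Proof.
elim: xs G => [|x xs IH] G /=; first by rewrite subrr mulr0.
under eq_low_sum => ys do rewrite qexp_prod_cons.
rewrite !qexp_prod_cons mulrDr IH mulrAC qexp_step.
by rewrite -!(mulrAC _ (qexp_prod _)); ring.
Qed.

(** The same telescope run from the other end, with the last weights scaled instead of the first. *)
Lemma up_sum_telescope (G : fps K) xs n :
  (1 - p) * up_sum p (fun ys => (G * qexp_prod ys) n) xs =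
  (G * qexp_prod xs) n.+1 - (G * qexp_prod (map ( *%R p) xs)) n.+1.
Proof.
elim: xs G => [|x xs IH] G /=; first by rewrite subrr mulr0.
under eq_up_sum => ys do rewrite qexp_prod_cons.
rewrite !qexp_prod_cons mulrDr IH mulrAC qexp_step.
by rewrite -!(mulrAC _ (qexp_prod _)); ring.
Qed.

Lemma qexp_hat_prod_scale xs m :
  qexp_hat_prod (map ( *%R p) xs) m = p ^+ m * qexp_hat_prod xs m.
Proof.
case: xs => [|x xs]; first by rewrite mulr0.
rewrite -[RHS]/(fps_dilate p _ m) fps_dilateM fps_dilate_prod /= /qexp_prod.
rewrite big_map fps_dilate_dilate; congr ((_ * _ : fps K) m).
by apply: eq_bigr => y _; rewrite fps_dilate_dilate.
Qed.

Lemma qexp_hat_prod_rec x xs n :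
  (1 + b * p ^+ n.+1) * qint p n.+1 * qexp_hat_prod (x :: xs) n.+1 =
  up_sum p (fun ys => qexp_hat_prod ys n) (x :: xs) +
  b * p ^+ n.+1 * low_sum p (fun ys => qexp_hat_prod (p * x :: ys) n) xs.
Proof.
have p1 : 1 - p != 0 by rewrite subr_eq0 eq_sym.
apply: (mulfI p1); rewrite mulrA mulrCA qint_geom /=.
rewrite !mulrDr (mulrCA (1 - p) (b * _)) low_sum_telescope up_sum_telescope.
set ys := map _ xs.
(* The head summand of [up_sum] involves the modified exponential and needs its own difference
   equation. *)
have -> : (1 - p) * (x * (fps_dilate x (qexp_hat b p) * qexp_prod ys) n) =
    qexp_hat_prod (x :: ys) n.+1 - qexp_hat_prod (p * x :: ys) n.+1 +
    b * (qexp_hat_prod (p * x :: ys) n.+1 -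
         qexp_hat_prod (p * (p * x) :: ys) n.+1).
  rewrite [LHS]mulrA -coef_fps_scaleX mulrA qexp_hat_dilate mulrDl mulrBl.
  by rewrite -mulrA !fpsD coef_fpsC mulrBl !fpsD !fpsN.
(* Scaling all weights by [p] multiplies the coefficient by p^(n+1). The terms at [p * x :: xs] then
   cancel, and (1 - p^(n+1))(1 + b p^(n+1)) remains. *)
have := qexp_hat_prod_scale (x :: xs) n.+1.
have := qexp_hat_prod_scale (p * x :: xs) n.+1.
by rewrite !map_cons -/ys /= => -> ->; ring.
Qed.

End Telescoping.

(** * Words of signed permutations *)

Fixpoint word_inv (w : seq int) : nat :=
  if w is a :: w' then (count (fun c => (c < a)%R) w' + word_inv w')%N else 0%N.

Lemma perm_insert j (N : int) (w : seq int) : perm_eq (insert j N w) (N :: w).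
Proof.
by rewrite /insert -cat1s perm_catCA /= perm_cons cat_take_drop perm_refl.
Qed.

Lemma word_inv_insert_max j (N : int) (w : seq int) :
  (j <= size w)%N -> all (fun a => a < N) w ->
  word_inv (insert j N w) = (size w - j + word_inv w)%N.
Proof.
elim: j w => [|j IH] w; last case: w => [|a w] //.
  by move=> _; rewrite all_count insert0 subn0 => /eqP <-.
move=> jw; rewrite [all _ _]/= => /andP[aN wN].
rewrite insertS /= IH // (seq.permP (perm_insert j N w)) /= ltNge (ltW aN) /=.
by rewrite add0n addnCA subSS.
Qed.

Lemma word_inv_insert_min j (N : int) (w : seq int) :
  (j <= size w)%N -> all (fun a => N < a) w ->
  word_inv (insert j N w) = (j + word_inv w)%N.
Proof.
elim: j w => [|j IH] w; last case: w => [|a w] //.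
  move=> _ wN; rewrite insert0 /=.
  suff -> : count (fun c => c < N) w = 0%N by [].
  apply/eqP; rewrite -leqn0 leqNgt -has_count -all_predC.
  by apply: sub_all wN => c /= /ltW; rewrite leNgt.
move=> jw; rewrite [all _ _]/= => /andP[aN wN].
rewrite insertS /= IH // (seq.permP (perm_insert j N w)) /= aN.
by rewrite add1n !addSn addnCA.
Qed.

Lemma insert_cat N u v : insert (size u) N (u ++ v) = u ++ N :: v.
Proof. by rewrite /insert take_size_cat // drop_size_cat. Qed.

Lemma nth_insert j N w : (j <= size w)%N -> nth 0 (insert j N w) j = N.
Proof. by move=> jw; rewrite nth_cat size_takel // ltnn subnn. Qed.

Lemma insertK j N w : (j <= size w)%N ->
  take j (insert j N w) ++ drop j.+1 (insert j N w) = w.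
Proof.
move=> jw; rewrite /insert take_size_cat ?size_takel // drop_cat size_takel //.
by rewrite ltnNge leqnSn subSnn /= drop0 cat_take_drop.
Qed.

Lemma find_insert (P : pred int) j N w :
  (j <= size w)%N -> P N -> ~~ has P w -> find P (insert j N w) = j.
Proof.
move=> jw PN; rewrite -{1}(cat_take_drop j w) has_cat negb_or => /andP[Pw _].
by rewrite find_cat (negPf Pw) /= PN addn0 size_takel.
Qed.

Definition insertion_steps m : seq (nat * bool) :=
  [seq (j, b) | j <- iota 0 m.+1, b <- [:: false; true]].
Arguments insertion_steps : simpl never.

Lemma mem_insertion_steps m jb : (jb \in insertion_steps m) = (jb.1 <= m)%N.
Proof.
case: jb => j b; apply/allpairsP/idP => [[[k c] [+ _ [-> _]]]|jm].
  by rewrite mem_iota ltnS.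
by exists (j, b); split; rewrite ?mem_iota //; case: (b).
Qed.

Lemma insertion_steps_uniq m : uniq (insertion_steps m).
Proof. by apply: allpairs_uniq; rewrite ?iota_uniq // => -[? ?] [? ?]. Qed.

(** Enumerating the words of B_n by insertion makes sums over them recursive in n. *)
Fixpoint signed_words n : seq (seq int) :=
  if n is m.+1 then
    [seq insert jb.1 ((-1) ^+ jb.2 * m.+1%:Z) w |
      w <- signed_words m,
      jb : nat * bool <- insertion_steps m]
  else [:: [::]].
Arguments signed_words : simpl never.

Lemma signed_wordsS m : signed_words m.+1 =
  [seq insert jb.1 ((-1) ^+ jb.2 * m.+1%:Z) w |
    w <- signed_words m, jb : nat * bool <- insertion_steps m].
Proof. by []. Qed.

Lemma signed_wordsP n w :
  (w \in signed_words n) = perm_eq (map absz w) (iota 1 n).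
Proof.
elim: n w => [|n IH] w; last rewrite signed_wordsS.
  by rewrite inE; case: w => // a w; apply/esym/negbTE/negP => /perm_size.
have rcons_iota : perm_eq (n.+1 :: iota 1 n) (iota 1 n.+1).
  by rewrite -(addn1 n) iotaD -cat1s perm_catC add1n addn1.
apply/allpairsP/idP => [[[u [j b]] /= []]|].
  rewrite IH => uP _ ->.
  rewrite (perm_trans (perm_map _ (perm_insert _ _ _))) //= abszMsign.
  by rewrite (perm_trans _ rcons_iota) // perm_cons.
move=> wP.
(* Deleting the letter of absolute value n + 1 and recording its position and sign undoes the
   insertion. *)
have /mapP[a aw na] : n.+1 \in map absz w.
  by rewrite (perm_mem wP) mem_iota add1n !ltnS leqnn.
case/splitPr: aw wP => u v wP.
exists (u ++ v, (size u, a < 0)); rewrite -insert_cat; split.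
- rewrite /= IH -(perm_cons n.+1) perm_sym (perm_trans rcons_iota) // perm_sym.
  by apply: perm_trans wP; rewrite na map_cat /= map_cat -cat1s perm_catCA.
- rewrite mem_insertion_steps /=.
  have := perm_size wP; rewrite size_iota size_map size_cat /= addnS => -[<-].
  exact: leq_addr.
- by rewrite /= na -intEsign.
Qed.

Lemma signed_words_size n w : w \in signed_words n -> size w = n.
Proof. by rewrite signed_wordsP => /perm_size; rewrite size_map size_iota. Qed.

Lemma signed_words_le n w : w \in signed_words n ->
  all (fun a => (`|a| <= n)%N) w.
Proof.
rewrite signed_wordsP => wP; apply/allP => a aw.
have : `|a|%N \in iota 1 n by rewrite -(perm_mem wP) map_f.
by rewrite mem_iota add1n ltnS => /andP[].
Qed.

Lemma signed_words_uniq n : uniq (signed_words n).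
Proof.
elim: n => // n IH; rewrite signed_wordsS.
apply: allpairs_uniq; rewrite ?insertion_steps_uniq //.
move=> ? ? /allpairsP[[u [j1 b1]] [uP jn ->]].
move=> /allpairsP[[v [k1 c1]] [/= vP kn ->]] /=.
rewrite !mem_insertion_steps /= in uP jn vP kn.
have [su sv] := (signed_words_size uP, signed_words_size vP).
rewrite -su in jn; rewrite -sv in kn.
set N := _ * _; set M := _ * _ => E.
have notin w : w \in signed_words n -> ~~ has (fun a => n < `|a|)%N w.
  move=> /signed_words_le; rewrite -all_predC; apply: sub_all => a /=.
  by rewrite leqNgt.
(* The insertion position is recovered as that of the first letter of absolute value above n. *)
have jk : j1 = k1.
  rewrite -(@find_insert (fun a => n < `|a|)%N j1 N u) ?notin ?abszMsign // E.
  by rewrite find_insert ?notin ?abszMsign.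
rewrite -jk in kn E *.
have := congr1 (nth 0 ^~ j1) E; rewrite /= !nth_insert //.
have -> : u = v by rewrite -(insertK N jn) E insertK.
by rewrite {E}/N {}/M; case: b1 c1 => -[].
Qed.

(** * Weighted sums over signed words *)

Section SignedWordSum.
Variables (K : fieldType) (p b : K).

(** For [b] = a / p this is p^(ell_D) a^neg. *)
Definition word_weight (w : seq int) : K :=
  p ^+ word_inv w * \prod_(a <- w) (if a < 0 then b * p ^+ `|a| else 1).

Lemma big_signed_wordsS (F : seq int -> K) n :
  \sum_(w <- signed_words n.+1) F w =
  \sum_(w <- signed_words n)
    (\sum_(j < n.+1) F (insert j n.+1%:Z w) +
     \sum_(j < n.+1) F (insert j (- n.+1%:Z) w)).
Proof.
rewrite signed_wordsS big_allpairs_dep; apply: eq_bigr => w _.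
rewrite /insertion_steps big_allpairs -(subn0 n.+1) -/(index_iota 0 n.+1).
rewrite big_mkord -big_split /=.
apply: eq_bigr => j _.
by rewrite !big_cons big_nil addr0 expr0 mul1r expr1 mulN1r.
Qed.


Lemma word_weight_insert j N w :
  word_weight (insert j N w) = p ^+ (word_inv (insert j N w)) *
    (if N < 0 then b * p ^+ absz N else 1) *
    \prod_(a <- w) (if a < 0 then b * p ^+ absz a else 1).
Proof.
by rewrite /word_weight (perm_big _ (perm_insert j N w)) big_cons mulrA.
Qed.

Hypothesis p_neq1 : p != 1.
Hypothesis qint_neq0 : forall m, qint p m.+1 != 0.
Hypothesis hat_neq0 : forall m, 1 + b * p ^+ m.+1 != 0.

Lemma qexp_prod0 xs : qexp_prod p xs 0%N = 1.
Proof.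
rewrite /qexp_prod; elim/big_rec: _ => // y f _ E.
by rewrite fpsM0 E /fps_dilate /qexp /qfact big_ord0 invr1 !mulr1.
Qed.

(** Induction on n for all weights at once, since an insertion rescales some of them. The start
    value [Some 0] makes the head block positive. *)
Lemma sum_signed_words_blocks n x xs :
  \sum_(w <- signed_words n) word_weight w * blocks (x :: xs) (Some 0) w =
  qfact_hat b p n * qexp_hat_prod p b (x :: xs) n.
Proof.
elim: n => [|n IH] in x xs *.
  rewrite big_seq1 blocks_nilr /word_weight big_nil /= fpsM0 qexp_prod0.
  rewrite /fps_dilate /qexp_hat.
  by rewrite expr0 !mulr1 mul1r divff ?qfact_hat_neq0.
rewrite qfact_hatS -mulrA qexp_hat_prod_rec // mulrDr big_signed_wordsS.
transitivity (\sum_(w <- signed_words n)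
  (word_weight w * up_sum p (fun ys => blocks ys (Some 0) w) (x :: xs) +
   b * p ^+ n.+1 * (word_weight w *
     low_sum p (fun ys => blocks (p * x :: ys) (Some 0) w) xs))).
  rewrite !big_seq; apply: eq_bigr => w wP.
  have [sz le_n] := (signed_words_size wP, signed_words_le wP).
  congr (_ + _).
    have wn : all (fun a => a < n.+1%:Z) w.
      by apply: sub_all le_n => a; lia.
    rewrite -(blocks_insert_max p (x :: xs) wn) // sz mulr_sumr.
    apply: eq_bigr => j _; rewrite word_weight_insert.
    by rewrite word_inv_insert_max ?sz -1?ltnS // exprD /word_weight /=; ring.
  have wn : all (fun a => - n.+1%:Z < a) w.
    by apply: sub_all le_n => a; lia.
  have := blocks_insert_min p x xs (Some 0) wn.
  (* The letter -(n+1) lies below 0, so it cannot enter the head block and that term is zero. *)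
  rewrite mul0r mul0r add0r => <-; rewrite sz !mulr_sumr.
  apply: eq_bigr => j _; rewrite word_weight_insert.
  by rewrite word_inv_insert_min ?sz -1?ltnS // exprD /word_weight /=; ring.
rewrite big_split -mulr_sumr up_sum_sum.
rewrite (low_sum_sum _ _ _ (fun w ys => blocks (_ :: ys) _ w)) mulrCA.
congr (_ + _ * _).
  rewrite /= IH mulrDr mulrCA; congr (_ + _).
  by rewrite -up_sum_scale; apply: eq_up_sum => ys; rewrite IH.
by rewrite -low_sum_scale; apply: eq_low_sum => ys; rewrite IH.
Qed.

End SignedWordSum.

(** * Statistics of signed permutations read off their words *)

Lemma mkseq_cons T (f : nat -> T) n :
  mkseq f n.+1 = f 0%N :: mkseq (fun i => f i.+1) n.
Proof. by rewrite /mkseq /= (iotaDl 1 0 n) -map_comp. Qed.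

Lemma word_des_mkseq (e : nat -> int) n :
  word_des (Some (e 0%N)) (mkseq (fun i => e i.+1) n) =
  (\sum_(i < n) (e i.+1 < e i)%R)%N.
Proof.
elim: n e => [|n IH] e; first by rewrite big_ord0.
by rewrite mkseq_cons big_ord_recl /= (IH (fun i => e i.+1)) -ltNge.
Qed.

Lemma word_maj_mkseq (e : nat -> int) n :
  word_maj (Some (e 0%N)) (mkseq (fun i => e i.+1) n) =
  (\sum_(i < n) i * (e i.+1 < e i)%R)%N.
Proof.
elim: n e => [|n IH] e; first by rewrite big_ord0.
rewrite mkseq_cons big_ord_recl mul0n add0n /= (IH (fun i => e i.+1)).
rewrite (word_des_mkseq (fun i => e i.+1)) -big_split.
by apply: eq_bigr => i _; rewrite /= mulSn addnC.
Qed.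

Lemma count_mkseq T (P : pred T) (f : nat -> T) n :
  count P (mkseq f n) = (\sum_(i < n) P (f i))%N.
Proof.
elim: n f => [|n IH] f; first by rewrite big_ord0.
by rewrite mkseq_cons big_ord_recl /= IH.
Qed.

Lemma word_inv_mkseq (f : nat -> int) n :
  word_inv (mkseq f n) =
  (\sum_(i < n) \sum_(j < n) ((i < j)%N && (f j < f i)%R))%N.
Proof.
elim: n f => [|n IH] f; first by rewrite big_ord0.
rewrite mkseq_cons big_ord_recl /= big_ord_recl /= add0n count_mkseq.
congr addn; rewrite IH; apply: eq_bigr => i _.
by rewrite big_ord_recl.
Qed.

Lemma big_mkseq (R : Type) (idx : R) (op : R -> R -> R) T (f : nat -> T) n
    (F : T -> R) :
  \big[op/idx]_(x <- mkseq f n) F x = \big[op/idx]_(i < n) F (f i).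
Proof.
by rewrite -(big_mkord xpredT (fun i => F (f i))) /index_iota subn0 big_map.
Qed.

Section PermWords.
Variable n : nat.
Implicit Types g h : {perm spoint n}.

Lemma card_set_sum (P : pred 'I_n) : #|[set i | P i]| = (\sum_(i < n) P i)%N.
Proof.
rewrite -sum1_card big_mkcond.
by apply: eq_bigr => i _; rewrite inE; case: P.
Qed.

Lemma entryE g (i : 'I_n) : entry g i.+1 = spoint_val (g (i, false)).
Proof. by rewrite /= valK. Qed.

Lemma spoint_val_neq0 (x : spoint n) : spoint_val x != 0.
Proof. by rewrite mulf_neq0 // signr_eq0. Qed.

Definition perm_word g : seq int := mkseq (fun i => entry g i.+1) n.

Lemma size_perm_word g : size (perm_word g) = n.
Proof. exact: size_mkseq. Qed.

Lemma card_DesB g : #|DesB g| = word_des (Some 0) (perm_word g).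
Proof. by rewrite card_set_sum (word_des_mkseq (entry g)). Qed.

Lemma majE g : maj g = word_maj (Some 0) (perm_word g).
Proof.
rewrite /maj (word_maj_mkseq (entry g)) big_mkcond; apply: eq_bigr => i _.
by rewrite inE; case: ifP; rewrite ?muln1 ?muln0.
Qed.

Lemma card_invE g : Defs.inv g = word_inv (perm_word g).
Proof.
rewrite /Defs.inv word_inv_mkseq pair_bigA -sum1_card big_mkcond.
by apply: eq_bigr => -[i j] _; rewrite inE /=; case: ifP.
Qed.

Lemma BnP g :
  reflect (forall x, g (spoint_opp x) = spoint_opp (g x)) (g \in Bn n).
Proof. by rewrite inE; apply: (iffP forallP) => H x; apply/eqP. Qed.

Lemma perm_word_inj : {in Bn n &, injective perm_word}.
Proof.
move=> g h /BnP gB /BnP hB gh; apply/permP => x.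
have E i : g (i, false) = h (i, false).
  apply: spoint_val_inj; rewrite -!entryE.
  by have := congr1 (nth 0 ^~ i) gh; rewrite /= !nth_mkseq.
by case: x => i [|]; rewrite ?E // -[(i, true)]/(spoint_opp (i, false)) gB hB E.
Qed.

Lemma perm_word_signed g : g \in Bn n -> perm_word g \in signed_words n.
Proof.
move=> /BnP gB; rewrite signed_wordsP.
have absE (i : 'I_n) : absz (entry g i.+1) = (g (i, false)).1.+1.
  by rewrite entryE /spoint_val abszMsign.
have wE i (hi : (i < n)%N) :
    nth 0%N (map absz (perm_word g)) i = (g (Ordinal hi, false)).1.+1.
  rewrite (nth_map 0) ?size_perm_word // nth_mkseq //.
  exact: (absE (Ordinal hi)).
have sz : size (map absz (perm_word g)) = n by rewrite size_map size_perm_word.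
have u : uniq (map absz (perm_word g)).
  apply/(uniqP 0%N) => i j; rewrite !inE sz => hi hj.
  rewrite !wE => -[/val_inj E].
  case gi: (g (Ordinal hi, false)) (gB (Ordinal hi, false)) E => [k b] gi' /= E.
  case gj: (g (Ordinal hj, false)) E => [l c] /= E; subst l.
  (* Equal absolute values give g(i) = g(j), hence i = j, or g(-i) = g(j), which is impossible for
     positive i and j. *)
  have [Eb|nb] := eqVneq b c.
    by move: gi; rewrite Eb -gj => /perm_inj[].
  have : g (spoint_opp (Ordinal hi, false)) = g (Ordinal hj, false).
    by rewrite gi' gj /spoint_opp /=; case: (b) (c) nb => -[].
  by move=> /perm_inj[].
have sub : {subset map absz (perm_word g) <= iota 1 n}.
  move=> a /(nthP 0%N)[i]; rewrite sz => hi <-; rewrite wE mem_iota.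
  by rewrite add1n !ltnS ltn_ord.
have [_ E] := uniq_min_size u sub (ltac:(by rewrite size_iota sz)).
by apply: uniq_perm; rewrite ?iota_uniq.
Qed.

Lemma perm_word_surj (w : seq int) : w \in signed_words n ->
  exists2 g, g \in Bn n & perm_word g = w.
Proof.
move=> wP; have sz := signed_words_size wP.
have wn (i : 'I_n) : (0 < absz (nth 0%R w i) <= n)%N.
  have : absz (nth 0 w i) \in map absz (w : seq int).
    by rewrite map_f // mem_nth ?sz.
  rewrite signed_wordsP in wP.
  by rewrite (perm_mem wP) mem_iota add1n ltnS.
have wn1 (i : 'I_n) : ((absz (nth 0%R w i)).-1 < n)%N.
  by have /andP[w0] := wn i; rewrite -{1}(prednK w0).
(* The odd extension of the word: signs multiply, and [.-1] accounts for the encoding of i + 1 by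
   i. *)
pose f (x : spoint n) : spoint n :=
  (Ordinal (wn1 x.1), (nth 0 w x.1 < 0) (+) x.2).
have u : uniq (map absz w).
  by rewrite signed_wordsP in wP; rewrite (perm_uniq wP) iota_uniq.
have f_inj : injective f.
  move=> [i b] [j c] [E Eb].
  have ij : i = j.
    have lt (k : 'I_n) : (val k < size w)%N by rewrite sz ltn_ord.
    apply: val_inj; apply/eqP; rewrite -(nth_uniq 0%N _ _ u) ?size_map ?lt //.
    rewrite !(nth_map 0) ?lt //.
    have [/andP[i0 _] /andP[j0 _]] := (wn i, wn j).
    by rewrite -(prednK i0) -(prednK j0) E.
  by subst j; move/addbI: Eb => ->.
exists (perm f_inj).
  by apply/BnP => x; rewrite !permE /f /spoint_opp /= addbN.
apply: (@eq_from_nth _ 0) => [|i]; rewrite size_perm_word ?sz // => hi.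
rewrite nth_mkseq // (entryE _ (Ordinal hi)) permE /f /spoint_val /= addbF.
have /andP[w0 _] := wn (Ordinal hi).
by rewrite prednK // -intEsign.
Qed.

Lemma sum_Bn_signed_words (V : nmodType) (F : seq int -> V) :
  \sum_(g in Bn n) F (perm_word g) = \sum_(w <- signed_words n) F w.
Proof.
rewrite -big_enum -(big_map perm_word predT); apply: perm_big.
apply: uniq_perm; rewrite ?signed_words_uniq //.
  rewrite map_inj_in_uniq ?enum_uniq // => g h.
  by rewrite !mem_enum; apply: perm_word_inj.
move=> w; apply/mapP/idP => [[g] | /perm_word_surj[g gB <-]].
  by rewrite mem_enum => /perm_word_signed wP ->.
by exists g; rewrite ?mem_enum.
Qed.

Lemma word_weight_perm (K : fieldType) (p a : K) g : p != 0 ->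
  p ^ lenD g * a ^+ neg g = word_weight p (a / p) (perm_word g).
Proof.
move=> p0; rewrite /lenD /lenB /word_weight -card_invE -addrA expfzDr // -mulrA.
congr (_ * _); rewrite big_mkseq -big_mkcond.
have -> : neg g = (\sum_(i < n | (entry g i.+1 < 0)%R) 1)%N.
  by rewrite sum1_card; apply: eq_card => i; rewrite !inE.
elim/big_rec3: _ => [|i m y x e_lt0]; first by rewrite oppr0 expr0z mul1r.
move=> E; rewrite -E; set e := entry _ _ in e_lt0 *.
(* A negative entry e adds |e| - 1 to ell_D; the -1 is the division by [p] in [a / p]. *)
have -> : - (e + y) - (1 + m)%N%:Z = (- y - m%:Z) + ((absz e)%:Z - 1).
  by case: e e_lt0 => k; lia.
rewrite !expfzDr // add1n exprS exprN1 -exprnP /=; ring.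
Qed.

Lemma sum_Bn_series (K : fieldType) (q p b : K) k : p != 1 ->
  (forall m, qint p m.+1 != 0) -> (forall m, 1 + b * p ^+ m.+1 != 0) ->
  \sum_(g in Bn n)
    word_weight p b (perm_word g) * block_series q (Some 0) (perm_word g) k =
  qfact_hat b p n * qexp_hat_prod p b (desc_pows q k.+1) n.
Proof.
move=> p1 qint0 hat0; rewrite desc_powsS -sum_signed_words_blocks //.
rewrite -desc_powsS.
exact: (sum_Bn_signed_words
  (fun w => word_weight p b w * block_series q (Some 0) w k)).
Qed.

End PermWords.

(** * From D_n to B_n *)

Section Descents.
Variables (n : nat) (g : {perm spoint n}).
Hypothesis n_ge2 : (2 <= n)%N.

Lemma zero_in_DesDE : zero_in_DesD g = (entry g 1 < - entry g 2).
Proof.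
apply/existsP/idP => [[i /andP[/eqP i0]] | lt12].
  by rewrite inE i0.
by exists (Ordinal (ltnW n_ge2)); rewrite inE.
Qed.

(** The two descent sets can differ only at 0, and 0 is in [DesB g] exactly when [entry g 1] is
    negative. *)
Lemma desD_DesB :
  (desD g + (entry g 1 < 0)%R)%N = (#|DesB g| + zero_in_DesD g)%N.
Proof.
rewrite zero_in_DesDE /desD /DesB /DesD !card_set_sum.
case: n g n_ge2 => // m h _; rewrite !big_ord_recl.
rewrite [LHS]addnAC [RHS]addnAC; congr addn; exact: addnC.
Qed.

Lemma entry1_neq0 : entry g 1 != 0.
Proof. by rewrite (entryE g (Ordinal (ltnW n_ge2))) spoint_val_neq0. Qed.

End Descents.

(** * The identity over a field with nonvanishing denominators *)

Section General.
Variables (K : fieldType) (q : K).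
Implicit Types (p a b : K).

Lemma fps_fracE (P Q : {poly K}) :
  fps_frac P Q = fps_of_poly P * fps_inv (fps_of_poly Q).
Proof. by []. Qed.

Lemma block_series_frac v w :
  block_series q v w =
  fps_frac (q ^+ word_maj v w *: 'X^(word_des v w)) (qpoch 'X q%:P (size w).+1).
Proof.
rewrite fps_fracE -block_seriesE -mulrA.
set Q := fps_of_poly _; have -> : Q * fps_inv Q = 1; last by rewrite mulr1.
by apply/fpsP/fps_mulfV; rewrite /Q qpochX0 oner_neq0.
Qed.

Lemma weight_seriesE n p a N (A : {set {perm spoint n}}) :
  weight_series q p a N A =
  \sum_(g in A) fps_frac (weight q p a g) (qpoch 'X q%:P N).
Proof. by apply/fpsP => m; rewrite fps_sumE. Qed.

Lemma fps_frac_XS (c : K) m (Q : {poly K}) :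
  fps_frac (c *: 'X^(m.+1)) Q = fps_of_poly 'X * fps_frac (c *: 'X^m) Q.
Proof. by rewrite !fps_fracE exprS scalerAr rmorphM mulrA. Qed.

Lemma weight_series_DesB n p a N : (2 <= n)%N ->
  fps_add (weight_series q p a N (Dn_zero n))
    (fps_add (fps_divX (weight_series q p a N (Dn_minus n)))
             (fps_mulX (weight_series q p a N (Dn_plus n)))) =
  \sum_(g in Dn n) fps_frac
    ((q ^+ maj g * p ^ lenD g * a ^+ neg g) *: 'X^#|DesB g|)
    (qpoch 'X q%:P N).
Proof.
move=> n2; rewrite !fps_addE !weight_seriesE fps_divX_sum fps_mulXE mulr_sumr.
rewrite !(big_mkcond (fun g => g \in _)) -!big_split; apply: eq_bigr => g _.
rewrite /weight /= [g \in Dn_zero n]inE in_setU /Dn_minus /Dn_plus !inE.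
set D := (_ && ~~ odd _); set c := _ * _ * _.
have := desD_DesB g n2; have := entry1_neq0 g n2.
case: D; last by rewrite !andbF !addr0.
(* The second and third cases are D_n^- and D_n^+, where des_D is one more and one less than des_B;
   the others lie in D_n^0, where the two agree. *)
case: zero_in_DesD; case: ltgtP => //= _ _; rewrite ?addn0 ?addn1 ?add0r ?addr0.
- by move=> [->].
- by move=> ->; rewrite fps_frac_XS fps_divX_mulX.
- by move=> <-; rewrite fps_frac_XS.
- by move=> ->.
Qed.

Lemma sum_Dn_Bn n (F : {perm spoint n} -> K) : 2 != 0 :> K ->
  \sum_(g in Dn n) F g =
  2^-1 * \sum_(g in Bn n) (F g + (-1) ^+ neg g * F g).
Proof.
move=> two0; rewrite mulr_sumr !(big_mkcond (fun g => g \in _)).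
apply: eq_bigr => g _; rewrite [g \in Dn n]inE; case: (g \in Bn n) => //=.
rewrite -signr_odd; case: odd => /=; first by rewrite mulN1r subrr mulr0.
by rewrite mul1r -mulr2n -[F g in RHS]mulr1 mulrnAr -mulr_natr; field.
Qed.

Lemma qexp_hat_prod_desc p b k :
  qexp_hat_prod p b (desc_pows q k.+1) =
  (\prod_(i < k) fps_dilate (q ^+ i) (qexp p)) *
  fps_dilate (q ^+ k) (qexp_hat b p).
Proof.
rewrite desc_powsS /= mulrC /qexp_prod /desc_pows.
rewrite (perm_big _ (permEl (perm_rev _))).
by rewrite big_mkseq.
Qed.

Lemma Dn_series_identity n p a : (2 <= n)%N ->
  2 != 0 :> K -> p != 0 -> p != 1 -> (forall m, qint p m.+1 != 0) ->
  (forall m, 1 + a * p ^+ m != 0) -> (forall m, 1 - a * p ^+ m != 0) ->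
  fps_add (weight_series q p a n.+1 (Dn_zero n))
    (fps_add (fps_divX (weight_series q p a n.+1 (Dn_minus n)))
             (fps_mulX (weight_series q p a n.+1 (Dn_plus n))))
  =1 (fun k : nat =>
    2^-1 * (qfact p n *
      fps_mul
        (\big[@fps_mul K/fps_one K]_(i < k) fps_dilate (q ^+ i) (qexp p))
        (fps_add
           (fps_scale (qpoch a p n)
              (fps_dilate (q ^+ k) (qexp_hat (- (a / p)) p)))
           (fps_scale (qpoch (- a) p n)
              (fps_dilate (q ^+ k) (qexp_hat (a / p) p)))) n)).
Proof.
move=> n2 two0 p0 p1 qint0 hp hm k.
rewrite weight_series_DesB // fps_sumE sum_Dn_Bn //; congr (_ * _).
set E := \big[_/_]_(i < k) _.
set G1 := fps_dilate _ _; set G2 := fps_dilate _ _.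
have -> : fps_mul E (fps_add (fps_scale (qpoch a p n) G1)
    (fps_scale (qpoch (- a) p n) G2)) n =
    qpoch a p n * (E * G1) n + qpoch (- a) p n * (E * G2) n.
  have C c f : fps_scale c f = fps_of_poly c%:P * f.
    by apply/fpsP => m; rewrite coef_fpsC.
  by rewrite fps_mulE fps_addE !C mulrDr !(mulrCA E) fpsD !coef_fpsC.
rewrite -!qexp_hat_prod_desc mulrDr !mulrA big_split addrC /=.
(* For these two values b p is a or -a, so [qfact_hat b p n] supplies the Pochhammer factor in front
   of the matching exponential. *)
have hat_p b : b = a / p \/ b = - (a / p) -> 
    qfact p n * qpoch (- (b * p)) p n * qexp_hat_prod p b (desc_pows q k.+1) n =
    \sum_(g in Bn n)
      word_weight p b (perm_word g) * block_series q (Some 0) (perm_word g) k.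
  move=> hb; rewrite sum_Bn_series // => [|m].
    by rewrite /qfact_hat (mulrC (qfact p n)).
  by case: hb => ->; rewrite exprS ?mulNr mulrA divfK.
have frac_word (g : {perm spoint n}) :
    fps_frac ((q ^+ maj g * p ^ lenD g * a ^+ neg g) *: 'X^#|DesB g|)
      (qpoch 'X q%:P n.+1) k =
    word_weight p (a / p) (perm_word g) *
    block_series q (Some 0) (perm_word g) k.
  rewrite -word_weight_perm // -mulrA mulrC -scalerA block_series_frac.
  rewrite size_perm_word majE card_DesB !fps_fracE -mul_polyC rmorphM -mulrA.
  by rewrite /= coef_fpsC.
have := hat_p _ (or_introl erefl); rewrite divfK // => ->.
have := hat_p _ (or_intror erefl); rewrite mulNr opprK divfK // => ->.
congr (_ + _); apply: eq_bigr => g _; rewrite frac_word // mulrA.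
(* The sign (-1)^neg is absorbed by replacing a with -a. *)
by rewrite -mulNr -!word_weight_perm // [(- a) ^+ _]exprNn; congr (_ * _); ring.
Qed.

End General.

(** * Nonvanishing in the field of rational functions *)

Section Indeterminates.
Implicit Types P : {mpoly rat[3]}.

(** Each side condition below is checked by evaluating all variables at 0 or all at 1. *)
Lemma tofrac_neq0 P (v : 'I_3 -> rat) : P.@[v] != 0 -> tofrac P != 0.
Proof. by rewrite tofrac_eq0; apply: contraNneq => ->; rewrite meval0. Qed.

Lemma two_neq0_Kqpa : 2 != 0 :> Kqpa.
Proof.
rewrite -(rmorph_nat (@tofrac {mpoly rat[3]})).
by apply: (@tofrac_neq0 _ (fun=> 1)); rewrite rmorph_nat.
Qed.

Lemma p_ind_neq0 : p_ind != 0.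
Proof. by apply: (@tofrac_neq0 _ (fun=> 1)); rewrite mevalXU. Qed.

Lemma p_ind_neq1 : p_ind != 1.
Proof.
rewrite -subr_eq0 -(rmorph1 (@tofrac {mpoly rat[3]})) -rmorphB.
by apply: (@tofrac_neq0 _ (fun=> 0)); rewrite rmorphB rmorph1 /= mevalXU.
Qed.

Lemma qint_p_ind_neq0 m : qint p_ind m.+1 != 0.
Proof.
rewrite /qint /p_ind; under eq_bigr do rewrite -rmorphXn.
rewrite -rmorph_sum; apply: (@tofrac_neq0 _ (fun=> 1)).
rewrite rmorph_sum (eq_bigr (fun=> 1)) => [|i _].
  by rewrite sumr_const card_ord pnatr_eq0.
by rewrite rmorphXn /= mevalXU expr1n.
Qed.

Lemma one_add_a_ind_neq0 m : 1 + a_ind * p_ind ^+ m != 0.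
Proof.
rewrite /p_ind /a_ind -rmorphXn -rmorphM -(rmorph1 (@tofrac {mpoly rat[3]})).
rewrite -rmorphD; apply: (@tofrac_neq0 _ (fun=> 0)).
by rewrite rmorphD rmorph1 rmorphM /= mevalXU mul0r addr0 oner_neq0.
Qed.

Lemma one_sub_a_ind_neq0 m : 1 - a_ind * p_ind ^+ m != 0.
Proof.
rewrite /p_ind /a_ind -rmorphXn -rmorphM -(rmorph1 (@tofrac {mpoly rat[3]})).
rewrite -rmorphB; apply: (@tofrac_neq0 _ (fun=> 0)).
by rewrite rmorphB rmorph1 rmorphM /= mevalXU mul0r subr0 oner_neq0.
Qed.

End Indeterminates.

Unset Implicit Arguments.
Theorem theorem6p3 (n : nat) (hn : (2 <= n)%N) :
  let q := q_ind in let p := p_ind in let a := a_ind in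
  fps_add (weight_series q p a n.+1 (Dn_zero n))
    (fps_add (fps_divX (weight_series q p a n.+1 (Dn_minus n)))
             (fps_mulX (weight_series q p a n.+1 (Dn_plus n))))
  =1 (fun k : nat =>
    2^-1 * (qfact p n *
      fps_mul
        (\big[@fps_mul Kqpa/fps_one Kqpa]_(i < k) fps_dilate (q ^+ i) (qexp p))
        (fps_add
           (fps_scale (qpoch a p n)
              (fps_dilate (q ^+ k) (qexp_hat (- (a / p)) p)))
           (fps_scale (qpoch (- a) p n)
              (fps_dilate (q ^+ k) (qexp_hat (a / p) p)))) n)).
Proof.
move=> q p a.
apply: Dn_series_identity hn two_neq0_Kqpa p_ind_neq0 p_ind_neq1
  qint_p_ind_neq0 one_add_a_ind_neq0 one_sub_a_ind_neq0.
Qed.
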